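(* Over $k=\mathbb{C}$, for every integer $i\ge0$ there exist morphisms of quadrics $Q_{4+2i}\to Q_{3+2i}$ and $Q_{5+2i}\to Q_{3+2i}$ providing polynomial representatives of, respectively, the $(2i+1)$-fold suspension of the Hopf map and the $(2i+1)$-fold suspension of the square of the Hopf map.
   Context: $Q_{2n-1}\subset\mathbb{A}^{2n}$ is the smooth affine variety $\sum_{i=1}^n x_iy_i=1$, and $Q_{2n}\subset\mathbb{A}^{2n+1}$ is the smooth affine variety $\sum_{i=1}^n x_iy_i=z(1-z)$. Over $\mathbb{C}$, $Q_n$ is isomorphic to the affine quadric $\sum_{j=0}^n x_j^2=1$, and $Q_n(\mathbb{C})$ is homotopy equivalent to $S^n$. A polynomial representative of a class $\alpha\in\pi_n(S^m)$ is a morphism of complex algebraic varieties $Q_n\to Q_m$ such that the induced map on complex points represents $\alpha$. The Hopf map is $\eta_{\mathrm{top}}:S^3\to S^2$; its square is $\eta_{\mathrm{top}}\circ\Sigma\eta_{\mathrm{top}}:S^4\to S^2$. *)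

(* Defs.v *)
From HB Require Import structures.
From mathcomp Require Import all_boot all_order all_algebra.
From mathcomp Require Import complex.
From mathcomp Require Import all_classical all_reals all_analysis.
From mathcomp Require mpoly.

Set Implicit Arguments.
Unset Strict Implicit.
Unset Printing Implicit Defensive.

Import Order.TTheory GRing.Theory Num.Theory.
Import numFieldNormedType.Exports.

Local Open Scope classical_set_scope.
Local Open Scope complex_scope.
Local Open Scope ring_scope.

(* The type [R[i]] itself carries no canonical topology; viewed as a
   numClosedFieldType it receives the topology of the modulus. *)
Definition Cplx (R : realType) : numClosedFieldType := R[i].

Section Quadrics.
Variable R : realType.
Notation C := (Cplx R).

(* The coordinates of the ambient affine space A^(n+1) are interleaved:
     x_1, y_1, x_2, y_2, ..., x_k, y_k      if n = 2k - 1,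
     x_1, y_1, x_2, y_2, ..., x_k, y_k, z   if n = 2k. *)
Definition pairing_sum n (x : 'rV[C]_n.+1) : C :=
  \sum_(k < n.+1./2) x 0 (inord k.*2) * x 0 (inord k.*2.+1).

(* Complex points of the quadric Q_n. *)
Definition quadric n : set 'rV[C]_n.+1 :=
  [set x | pairing_sum x =
           if odd n then 1 else x 0 ord_max * (1 - x 0 ord_max)].

Definition polymap n m (p : 'I_m.+1 -> mpoly.mpoly n.+1 C)
    (x : 'rV[C]_n.+1) : 'rV[C]_m.+1 :=
  \row_j mpoly.meval (fun k => x 0 k) (p j).

(* Morphisms Q_n -> Q_m are the restrictions of the polynomial maps between
   the ambient affine spaces that carry Q_n(C) into Q_m(C). *)
Definition quadric_morphism n m (p : 'I_m.+1 -> mpoly.mpoly n.+1 C) : Prop :=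
  forall x, quadric x -> quadric (polymap p x).

(* The isomorphism from the affine quadric \sum_(j <= n) u_j^2 = 1 onto Q_n:
     x_k, y_k = u_(2k-2) +- i u_(2k-1)                           for n odd,
     x_k, y_k = (u_(2k-2) +- i u_(2k-1)) / 2, z = (1 + u_n) / 2  for n even. *)
Definition quadric_of_squares n (u : 'rV[C]_n.+1) : 'rV[C]_n.+1 :=
  \row_(j < n.+1)
    if ~~ odd n && (j == ord_max) then (1 + u 0 j) / 2
    else (if odd n then 1 else 2^-1) *
         (u 0 (inord j./2.*2)
          + (-1) ^+ odd j * (0 +i* 1 : C) * u 0 (inord j./2.*2.+1)).

Definition sphere n : set 'rV[R]_n.+1 := [set v | \sum_j v 0 j ^+ 2 = 1].

Definition sphere_base n : 'rV[R]_n.+1 := delta_mx 0 0.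

(* The homotopy equivalence S^n -> Q_n(C): the sphere is the set of real points
   of the quadric \sum_(j <= n) u_j^2 = 1, and the complex points of the latter
   retract onto it by deformation. *)
Definition sphere_to_quadric n (v : 'rV[R]_n.+1) : 'rV[C]_n.+1 :=
  quadric_of_squares (map_mx (real_complex R : R -> C) v).

(* [f] and [g] are homotopic, as maps from X to Y, relative to A. *)
Definition homotopic_rel (V W : topologicalType) (A X : set V) (Y : set W)
    (f g : V -> W) : Prop :=
  exists H : R * V -> W,
    [/\ {within `[0%R, 1%R]%classic `*` X, continuous H},
        forall t x, 0 <= t <= 1 -> X x -> Y (H (t, x)),
        forall x, X x -> H (0, x) = f x,
        forall x, X x -> H (1, x) = g x
      & forall t x, 0 <= t <= 1 -> A x -> H (t, x) = f x].

(* [f : Q_n(C) -> Q_m(C)] represents the class in pi_n(S^m) of the based map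
   [alpha : S^n -> S^m]: under the homotopy equivalences S^n -> Q_n(C) and
   S^m -> Q_m(C), it corresponds to an element [g] of the based homotopy class
   of [alpha]. No base point is fixed by [f], so the comparison with [g] is
   through a free homotopy. *)
Definition represents n m (f : 'rV[C]_n.+1 -> 'rV[C]_m.+1)
    (alpha : 'rV[R]_n.+1 -> 'rV[R]_m.+1) : Prop :=
  exists g : 'rV[R]_n.+1 -> 'rV[R]_m.+1,
    homotopic_rel [set sphere_base n] (@sphere n) (@sphere m) g alpha /\
    homotopic_rel set0 (@sphere n) (@quadric m)
      (f \o @sphere_to_quadric n) (@sphere_to_quadric m \o g).

Definition polynomial_representative n m (p : 'I_m.+1 -> mpoly.mpoly n.+1 C)
    (alpha : 'rV[R]_n.+1 -> 'rV[R]_m.+1) : Prop :=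
  quadric_morphism p /\ represents (polymap p) alpha.

(* With z = v_0 + i v_1 and w = v_2 + i v_3, this is
     (z, w) |-> (|z|^2 - |w|^2, 2 z conj(w)) in R x C. *)
Definition hopf (v : 'rV[R]_4) : 'rV[R]_3 :=
  let a := v 0 (inord 0) in let b := v 0 (inord 1) in
  let c := v 0 (inord 2) in let d := v 0 (inord 3) in
  \row_j [:: a ^+ 2 + b ^+ 2 - c ^+ 2 - d ^+ 2;
             2 * (a * c + b * d);
             2 * (b * c - a * d)]`_j.

(* Suspension in coordinates, the last one being the suspension parameter:
   (r u, t) |-> (r f(u), t) for u in S^n and r^2 + t^2 = 1, 0 <= r. *)
Definition susp n m (f : 'rV[R]_n.+1 -> 'rV[R]_m.+1) (v : 'rV[R]_n.+2) :
    'rV[R]_m.+2 :=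
  let u : 'rV[R]_n.+1 := \row_j v 0 (lift ord_max j) in
  let r := Num.sqrt (\sum_j u 0 j ^+ 2) in
  \row_j if unlift ord_max j is Some k then r * f (r^-1 *: u) 0 k
         else v 0 ord_max.

Definition hopf_square : 'rV[R]_5 -> 'rV[R]_3 := hopf \o susp hopf.

(* The iterated suspensions are defined separately for the two maps so that
   3 + k.+1, 4 + k.+1 and 2 + k.+1 are convertible to successors. *)
Fixpoint hopf_susp k : 'rV[R]_(3 + k).+1 -> 'rV[R]_(2 + k).+1 :=
  if k is k'.+1 then susp (@hopf_susp k') else hopf.

Fixpoint hopf_square_susp k : 'rV[R]_(4 + k).+1 -> 'rV[R]_(2 + k).+1 :=
  if k is k'.+1 then susp (@hopf_square_susp k') else hopf_square.

End Quadrics.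

Arguments hopf_susp : clear implicits.
Arguments hopf_square_susp : clear implicits.

(* Main.v *)
Require Import Defs.
From HB Require Import structures.
From mathcomp Require Import all_boot all_order all_algebra.
From mathcomp Require Import complex.
From mathcomp Require Import all_classical all_reals all_analysis.
From mathcomp Require mpoly.
Import -(notations) mpoly.
From mathcomp Require Import ring lra.

Set Implicit Arguments.
Unset Strict Implicit.
Unset Printing Implicit Defensive.

Import Order.TTheory GRing.Theory Num.Theory.
Import numFieldNormedType.Exports.

Local Open Scope classical_set_scope.
Local Open Scope complex_scope.
Local Open Scope ring_scope.

(** View Q_n as the complex sphere \sum_j u_j^2 = 1. For m odd, the points of Q_m
    are the pairs of rows X, Y with \sum_k X_k Y_k = 1; for fixed X <> 0 the rows Y
    form an affine space, so a map into Q_m is determined up to homotopy by its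
    nowhere vanishing row X, and two maps whose rows are joined by segments missing
    0 are homotopic ([straight_line_homotopy]). It therefore suffices to find
    polynomial rows without complex zeros whose restrictions to the real sphere can
    be pushed along segments to the given suspensions.

    Hopf map. Let h = (h0, h1, h2) be the Hopf polynomials in a, b, c, d, so that
    h0^2 + h1^2 + h2^2 = M^2 with M = a^2 + b^2 + c^2 + d^2, and let M + t^2 = 1.
    Up to rescaling, the suspended Hopf map is the row (h0 + i h1, h2 + i t). This
    row has complex zeros, but correcting it by multiples of t removes them:
      X = (h0 + i h1 + t (a + i c) (b + i d), h2 + i t (1 + a^2 + c^2))
    has a polynomial partner Y with X.Y = M^2 + t^2 (1 + M) = 1
    ([eta_unimodular]). The formula has a conceptual origin: if P is the projector
    of the tautological quaternionic line bundle on Q_4 (a model of the quaternionic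
    projective line), the reflection 1 - 2 P represents the nonzero element of
    pi_4(Sp_4), and elementary symplectic operations reduce it to a matrix in SL_2
    whose first row is X up to linear changes of coordinates. On the real sphere, a
    zero of a row on the segment from X to the suspended Hopf map must have t = 0,
    because the last imaginary part is a positive multiple of t; there both ends
    are h ([segment_avoids_zero_hopf]).

    Square of the Hopf map. Let tau = t1 + i t2 with M + t1^2 + t2^2 = 1. Since
    M^2 + (1 + M) (1 - M) = 1, the double suspension of the Hopf map has the
    polynomial form (h, (1 + M) tau, conj tau) : Q_5 -> Q_4 ([eta_lift]). It is
    composed with the previous map. On the real sphere the last imaginary part is
    again a positive multiple of t2, and for t2 = 0 the remaining vectors of R^3,
    the composite and its target, have positive inner product
    ([hopf_comparison_pos]), so that the segment between them misses 0
    ([segment_avoids_zero_hopf_square]).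

    Higher suspensions. The linear forms u + i u' in the new coordinates are
    appended to the row X; where they all vanish, the old coordinates satisfy the
    equation of the smaller quadric, on which X has no zero
    ([suspended_unimodular]). The suspensions of the statement are put in closed
    form by [hopf_suspE] and [hopf_square_suspE]. *)

(** * The polynomial rows *)

Section Core.
Variable R : realType.
Notation C := (Cplx R).
Definition imag : C := 0 +i* 1.
Local Notation I := imag.

Lemma imag_sqr : I * I = -1.
Proof. by apply/eqP; rewrite eq_complex /=; apply/andP; split; apply/eqP; ring. Qed.

(** Points are given by their sequences of coordinates; this gives one formula for
    the real Hopf map and for its complexification, in every ambient dimension. *)
Definition hopf_coord (A : comNzRingType) (c : nat -> A) (j : nat) : A :=
  [:: c 0%N ^+ 2 + c 1%N ^+ 2 - c 2%N ^+ 2 - c 3%N ^+ 2;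
      2 * (c 0%N * c 2%N + c 1%N * c 3%N);
      2 * (c 1%N * c 2%N - c 0%N * c 3%N)]`_j.

Lemma hopf_coordE (A : comNzRingType) (c : nat -> A) :
  (hopf_coord c 0 = c 0%N ^+ 2 + c 1%N ^+ 2 - c 2%N ^+ 2 - c 3%N ^+ 2)
  * (hopf_coord c 1 = 2 * (c 0%N * c 2%N + c 1%N * c 3%N))
  * (hopf_coord c 2 = 2 * (c 1%N * c 2%N - c 0%N * c 3%N)).
Proof. by []. Qed.

Lemma hopf_coord_norm (A : comNzRingType) (c : nat -> A) :
  hopf_coord c 0 ^+ 2 + hopf_coord c 1 ^+ 2 + hopf_coord c 2 ^+ 2
  = (c 0%N ^+ 2 + c 1%N ^+ 2 + c 2%N ^+ 2 + c 3%N ^+ 2) ^+ 2.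
Proof. rewrite /hopf_coord /=; ring. Qed.

(** The row (x0, x1) and its partner (y0, y1) on Q_4, in the coordinates
    a, b, c, d, t of the complex sphere. *)
Definition eta_x0 (c : nat -> C) : C :=
  hopf_coord c 0 + I * hopf_coord c 1
  + c 4%N * ((c 0%N + I * c 2%N) * (c 1%N + I * c 3%N)).
Definition eta_y0 (c : nat -> C) : C :=
  hopf_coord c 0 - I * hopf_coord c 1
  - c 4%N * ((c 0%N - I * c 2%N) * (c 1%N - I * c 3%N)).
Definition eta_x1 (c : nat -> C) : C :=
  hopf_coord c 2 + I * c 4%N * (1 + c 0%N ^+ 2 + c 2%N ^+ 2).
Definition eta_y1 (c : nat -> C) : C :=
  hopf_coord c 2 - I * c 4%N * (1 + c 1%N ^+ 2 + c 3%N ^+ 2).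

(** The factor 1 + M; it reappears in the partners of the suspended rows. *)
Definition eta_weight (c : nat -> C) : C :=
  1 + c 0%N ^+ 2 + c 1%N ^+ 2 + c 2%N ^+ 2 + c 3%N ^+ 2.

(** The left-hand side is M^2 + t^2 (1 + M). Recording the multiple of the equation
    of the sphere, and not only the value 1, is what permits the suspension of the
    row to larger quadrics. *)
Lemma eta_unimodular c :
  eta_x0 c * eta_y0 c + eta_x1 c * eta_y1 c =
  1 + (c 0%N ^+ 2 + c 1%N ^+ 2 + c 2%N ^+ 2 + c 3%N ^+ 2 + c 4%N ^+ 2 - 1)
      * eta_weight c.
Proof.
rewrite /eta_x0 /eta_y0 /eta_x1 /eta_y1 /eta_weight /hopf_coord /=.
ring: imag_sqr.
Qed.

(** A polynomial form Q_5 -> Q_4 of the double suspension of the Hopf map: with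
    tau = c_4 + i c_5, the last two coordinates v3, v4 are defined by
    v3 + i v4 = (1 + M) tau and v3 - i v4 = conj tau. *)
Definition eta_lift (c : nat -> C) (l : nat) : C :=
  let m := (eta_weight c - 1) / 2 in
  match l with 3 => c 4%N + m * (c 4%N + I * c 5%N)
             | 4 => c 5%N + m * (c 5%N - I * c 4%N)
             | _ => hopf_coord c l end.

Lemma eta_liftE c :
  (eta_lift c 0 = hopf_coord c 0) * (eta_lift c 1 = hopf_coord c 1)
  * (eta_lift c 2 = hopf_coord c 2)
  * (eta_lift c 3 = c 4%N + (eta_weight c - 1) / 2 * (c 4%N + I * c 5%N))
  * (eta_lift c 4 = c 5%N + (eta_weight c - 1) / 2 * (c 5%N - I * c 4%N)).
Proof. by []. Qed.

Lemma eta_lift_norm c :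
  eta_lift c 0 ^+ 2 + eta_lift c 1 ^+ 2 + eta_lift c 2 ^+ 2 + eta_lift c 3 ^+ 2
    + eta_lift c 4 ^+ 2 - 1 =
  (c 0%N ^+ 2 + c 1%N ^+ 2 + c 2%N ^+ 2 + c 3%N ^+ 2 + c 4%N ^+ 2 + c 5%N ^+ 2 - 1)
    * eta_weight c.
Proof.
rewrite /eta_lift /eta_weight /hopf_coord /=.
by field: imag_sqr; rewrite ?pnatr_eq0.
Qed.

(** * Segments between the rows and the suspended Hopf maps *)

(** On the sphere t2 = 0, the composite row and the square of the Hopf map are both
    close to the Hopf map of (q0, q1, q2, t) and make an acute angle. The inner
    product is a main term, the inner product of the Hopf images of
    (e q, k t) and (q, t), plus m z where z is a pairing of the correction P
    with the unit vector (a0, a1, a2). The main term is bounded below through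
    <hopf v, hopf w> = 2 |<v, w>|^2 - |v|^2 |w|^2, with the Hermitian <v, w>, and
    |z| by Cauchy-Schwarz; what remains is an inequality in y = e^2 on [0, 1]. *)
Lemma hopf_comparison_pos (e t q0 q1 q2 k a0 a1 a2 m : R) :
  0 <= e -> e ^+ 2 + t ^+ 2 = 1 ->
  q0 ^+ 2 + q1 ^+ 2 + q2 ^+ 2 = e ^+ 2 ->
  k = 1 + e ^+ 2 / 2 ->
  a0 = q0 ^+ 2 + q1 ^+ 2 - q2 ^+ 2 - t ^+ 2 ->
  a1 = 2 * (q0 * q2 + q1 * t) ->
  a2 = 2 * (q1 * q2 - q0 * t) ->
  m = e ^+ 2 * t / 2 ->
  0 < ((e * q0) ^+ 2 + (e * q1) ^+ 2 - (e * q2) ^+ 2 - (k * t) ^+ 2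
        + m * (e ^+ 2 * q1 * q2 + e * k * t * q0)) * a0
    + (2 * (e * q0 * (e * q2) + e * q1 * (k * t))
        - m * (e ^+ 2 * q0 * q1 - e * k * t * q2)) * a1
    + (2 * (e * q1 * (e * q2) - e * q0 * (k * t))
        + m * (1 + e ^+ 2 * (q0 ^+ 2 + q2 ^+ 2))) * a2.
Proof.
move=> e0 et qe kE a0E a1E a2E mE.
pose P0 := e ^+ 2 * q1 * q2 + e * k * t * q0.
pose P1 := e ^+ 2 * q0 * q1 - e * k * t * q2.
pose P2 := 1 + e ^+ 2 * (q0 ^+ 2 + q2 ^+ 2).
pose y := e ^+ 2.
have y0 : 0 <= y by rewrite sqr_ge0.
have t2 : t ^+ 2 = 1 - y by rewrite -et /y; ring.
have y1 : y <= 1 by have := sqr_ge0 t; lra.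
have aa : a0 ^+ 2 + a1 ^+ 2 + a2 ^+ 2 = 1.
  have -> : a0 ^+ 2 + a1 ^+ 2 + a2 ^+ 2
      = (q0 ^+ 2 + q1 ^+ 2 + q2 ^+ 2 + t ^+ 2) ^+ 2 by rewrite a0E a1E a2E; ring.
  by rewrite qe et expr1n.
pose g := e ^+ 2 * (q0 ^+ 2 + q2 ^+ 2).
have PP : P0 ^+ 2 + P1 ^+ 2 + P2 ^+ 2 = 1 + g * (2 + y ^+ 2 + k ^+ 2 * t ^+ 2).
  have E : q1 ^+ 2 = y - q0 ^+ 2 - q2 ^+ 2 by rewrite /y -qe; ring.
  have -> : P0 ^+ 2 + P1 ^+ 2 + P2 ^+ 2
      = g * (e ^+ 2 * q1 ^+ 2 + (k * t) ^+ 2) + (1 + g) ^+ 2.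
    by rewrite /P0 /P1 /P2 /g; ring.
  rewrite E /g /y; ring.
have gy : g <= y ^+ 2.
  rewrite /g -/y expr2; apply: ler_wpM2l => //.
  by rewrite /y -qe; have := sqr_ge0 q1; lra.
have g0 : 0 <= g by rewrite /g mulr_ge0 // addr_ge0 // sqr_ge0.
(* B is a polynomial bound of |P|: |P|^2 <= 1 + 3 y^2 + y^4 / 4 - y^5 / 4 <= B^2. *)
pose B := 1 + 3 / 2 * y ^+ 2.
have PB : P0 ^+ 2 + P1 ^+ 2 + P2 ^+ 2 <= B ^+ 2.
  rewrite PP t2 kE -/y /B.
  have H : 0 <= (2 + y ^+ 2 + (1 + y / 2) ^+ 2 * (1 - y)).
    by rewrite !addr_ge0 ?sqr_ge0 // mulr_ge0 ?sqr_ge0 ?subr_ge0.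
  apply: (@le_trans _ _ (1 + y ^+ 2 * (2 + y ^+ 2 + (1 + y / 2) ^+ 2 * (1 - y)))).
    by rewrite lerD2l ler_wpM2r.
  have -> : (1 + 3 / 2 * y ^+ 2) ^+ 2 =
      1 + y ^+ 2 * (2 + y ^+ 2 + (1 + y / 2) ^+ 2 * (1 - y))
      + (2 * y ^+ 4 + y ^+ 5 / 4) by field.
  by rewrite lerDl addr_ge0 ?mulr_ge0 ?exprn_ge0 ?divr_ge0 ?exprn_ge0.
pose z := P0 * a0 - P1 * a1 + P2 * a2.
have B0 : 0 <= B by rewrite /B addr_ge0 // mulr_ge0 // ?sqr_ge0 //; lra.
have zB : `|z| <= B.
  rewrite -[B]ger0_norm // -ler_sqr ?nnegrE // !real_normK ?num_real //.
  apply: le_trans PB.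
  have -> : z ^+ 2 = (P0 ^+ 2 + P1 ^+ 2 + P2 ^+ 2) * (a0 ^+ 2 + a1 ^+ 2 + a2 ^+ 2)
    - ((P0 * a1 + P1 * a0) ^+ 2 + (P0 * a2 - P2 * a0) ^+ 2 + (P1 * a2 + P2 * a1) ^+ 2).
    by rewrite /z; ring.
  by rewrite aa mulr1 lerBlDr lerDl !addr_ge0 ?sqr_ge0.
set D := (X in 0 < X).
have -> : D = 2 * ((e * y + k * t ^+ 2) ^+ 2 + (t * (k - e) * q2) ^+ 2)
     - (y ^+ 2 + k ^+ 2 * t ^+ 2) + m * z.
  have E : q1 ^+ 2 = e ^+ 2 - q0 ^+ 2 - q2 ^+ 2 by rewrite -qe; ring.
  have E' : t ^+ 2 = 1 - e ^+ 2 by rewrite -et; ring.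
  rewrite /D /z /P0 /P1 /P2 a0E a1E a2E /y; clear kE mE.
  ring: E E'.
have ey : y ^+ 2 <= e * y.
  rewrite expr2; apply: ler_wpM2r => //; rewrite /y expr2 ler_piMl //.
  by rewrite -(@expr_le1 _ 2) // -/y.
have mz : - (y / 2 * `|t| * B) <= m * z.
  rewrite -[_ <= _]opprK.
  have : `|m * z| <= y / 2 * `|t| * B.
    rewrite normrM; apply: ler_pM; rewrite ?normr_ge0 //.
    have -> : m = y / 2 * t by rewrite mE /y; ring.
    rewrite normrM ger0_norm //; lra.
  by rewrite ler_norml => /andP[].
(* The tangent at 7/10 bounds |t| = sqrt (1 - y) by a linear function of y. *)
have tb : `|t| <= (1 - y) * (5 / 7) + 7 / 20.
  have : `|t| ^+ 2 = 1 - y by rewrite real_normK ?num_real.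
  have := sqr_ge0 (`|t| - 7 / 10); nra.
have mz' : y / 2 * `|t| * B <= y / 2 * ((1 - y) * (5 / 7) + 7 / 20) * B.
  by apply: ler_wpM2r => //; apply: ler_wpM2l => //; lra.
have sq : (y ^+ 2 + k * (1 - y)) ^+ 2 <= (e * y + k * t ^+ 2) ^+ 2.
  have k0 : 0 <= k by rewrite kE -/y; lra.
  have e0' : 0 <= e * y by rewrite mulr_ge0.
  have kt0 : 0 <= k * (1 - y) by rewrite mulr_ge0 // subr_ge0.
  by rewrite t2 ler_sqr ?nnegrE ?lerD2r // addr_ge0 ?sqr_ge0.
have r0 := sqr_ge0 (t * (k - e) * q2).
have key : 0 < 2 * (y ^+ 2 + k * (1 - y)) ^+ 2 - (y ^+ 2 + k ^+ 2 * (1 - y))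
   - y / 2 * ((1 - y) * (5 / 7) + 7 / 20) * B.
  rewrite /B kE -/y; clear -y0 y1; nra.
rewrite t2 in sq *.
lra.
Qed.

End Core.

Section Nonvanishing.
Variable R : realType.
Notation C := (Cplx R).
Notation I := (imag R).

Definition realC (c : nat -> R) (l : nat) : C := (c l)%:C.

(** For f quadratic this is the radial extension r f(v / r), r = |v|, of f; the
    convention 0^-1 = 0 gives the value 0 at the origin. *)
Definition normalized p (f : (nat -> R) -> nat -> R) (c : nat -> R) (j : nat) : R :=
  (Num.sqrt (\sum_(l < p) c l ^+ 2))^-1 * f c j.

Definition hopf_profile := normalized 4 (@hopf_coord R).
Definition hopf_square_coord (c : nat -> R) : nat -> R :=
  hopf_coord (fun l => if (l < 3)%N then hopf_profile c l else c 4%N).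
Definition hopf_square_profile := normalized 5 hopf_square_coord.

(** The target (phi_0 + i phi_1, phi_2 + i c_p) is the suspension whose coordinates
    are the three values of phi and the last coordinate c_p of the source. *)
Definition segment_avoids_zero p (F0 F1 : (nat -> C) -> C)
    (phi : (nat -> R) -> nat -> R) :=
  forall (c : nat -> R) s, 0 <= s <= 1 -> \sum_(l < p.+1) c l ^+ 2 = 1 ->
  (1 - s)%:C * F0 (realC c) + s%:C * ((phi c 0%N)%:C + I * (phi c 1%N)%:C) = 0 ->
  (1 - s)%:C * F1 (realC c) + s%:C * ((phi c 2%N)%:C + I * (c p)%:C) = 0 -> False.

Lemma sum4_sqr (c : nat -> R) :
  \sum_(l < 4) c l ^+ 2 = c 0%N ^+ 2 + c 1%N ^+ 2 + c 2%N ^+ 2 + c 3%N ^+ 2.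
Proof. by rewrite !big_ord_recr big_ord0 /= add0r. Qed.

Lemma realC_imag_eq0 (x y : R) : x%:C + I * y%:C = 0 -> x = 0 /\ y = 0.
Proof.
move=> /eqP; rewrite eq_complex /= => /andP[/eqP re /eqP im].
split; [rewrite -re | rewrite -im]; ring.
Qed.

Lemma hopf_coord_realC (c : nat -> R) j :
  (j < 3)%N -> hopf_coord (realC c) j = (hopf_coord c j)%:C.
Proof. by case: j => [|[|[|//]]] _; rewrite !hopf_coordE /realC; ring. Qed.

Lemma eta_lift_realC (c : nat -> R) :
  let m := (c 0%N ^+ 2 + c 1%N ^+ 2 + c 2%N ^+ 2 + c 3%N ^+ 2) / 2 in
  (eta_lift (realC c) 0 = (hopf_coord c 0)%:C) *
  (eta_lift (realC c) 1 = (hopf_coord c 1)%:C) *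
  (eta_lift (realC c) 2 = (hopf_coord c 2)%:C) *
  (eta_lift (realC c) 3 = (c 4%N + m * c 4%N)%:C + I * (m * c 5%N)%:C) *
  (eta_lift (realC c) 4 = (c 5%N + m * c 5%N)%:C - I * (m * c 4%N)%:C).
Proof.
move=> m; rewrite !eta_liftE.
have -> : (eta_weight (realC c) - 1) / 2 = m%:C :> C.
  by rewrite /eta_weight /realC /m; field; rewrite ?pnatr_eq0.
by rewrite !hopf_coord_realC // /realC; repeat split; ring.
Qed.

Lemma eta_x1_lift_realC (c : nat -> R) :
  let m := (c 0%N ^+ 2 + c 1%N ^+ 2 + c 2%N ^+ 2 + c 3%N ^+ 2) / 2 in
  let g := hopf_coord c in
  let k := 1 + g 0%N ^+ 2 + g 2%N ^+ 2 in
  eta_x1 (eta_lift (realC c)) =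
  (2 * (g 1%N * g 2%N - g 0%N * (c 4%N + m * c 4%N)) + m * c 4%N * k)%:C
  + I * (c 5%N * ((1 + m) * k - 2 * m * g 0%N))%:C.
Proof.
move=> m g k; rewrite /eta_x1 hopf_coordE !eta_lift_realC // -/m -/g /k {k}.
move: m (g 0%N) (g 1%N) (g 2%N) => m g0 g1 g2; ring: (imag_sqr R).
Qed.

Lemma eta_x0_lift_realC (c : nat -> R) : c 5%N = 0 ->
  let m := (c 0%N ^+ 2 + c 1%N ^+ 2 + c 2%N ^+ 2 + c 3%N ^+ 2) / 2 in
  let g := hopf_coord c in
  let t := c 4%N + m * c 4%N in
  eta_x0 (eta_lift (realC c)) =
  (g 0%N ^+ 2 + g 1%N ^+ 2 - g 2%N ^+ 2 - t ^+ 2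
     + m * c 4%N * (g 1%N * g 2%N + g 0%N * t))%:C
  + I * (2 * (g 0%N * g 2%N + g 1%N * t)
         - m * c 4%N * (g 0%N * g 1%N - g 2%N * t))%:C.
Proof.
move=> t0 m g t; rewrite /eta_x0 !hopf_coordE !eta_lift_realC // -/m -/g /t t0 {t}.
move: m (g 0%N) (g 1%N) (g 2%N) => m g0 g1 g2; ring: (imag_sqr R).
Qed.

Lemma segment_pos (s r : R) : 0 <= s <= 1 -> 0 < r -> 0 < (1 - s) * r + s.
Proof. move=> /andP[s0 s1] r0; nra. Qed.

(** The imaginary part of the second coordinate is a positive multiple of c_4. Where
    c_4 = 0, the whole segment is constantly equal to the Hopf map, which has
    norm 1. *)
Lemma segment_avoids_zero_hopf :
  segment_avoids_zero 4 (@eta_x0 R) (@eta_x1 R) hopf_profile.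
Proof.
move=> c s s01; rewrite !big_ord_recr big_ord0 /= add0r => sph.
move=> /eqP; rewrite eq_complex /= => /andP[/eqP re0 /eqP im0].
move=> /eqP; rewrite eq_complex /= => /andP[/eqP re1 /eqP im1].
have t0 : c 4%N = 0.
  have : c 4%N * ((1 - s) * (1 + c 0%N ^+ 2 + c 2%N ^+ 2) + s) = 0.
    rewrite -im1; ring.
  move=> /eqP; rewrite mulf_eq0 => /orP[/eqP //|]; rewrite gt_eqF // segment_pos //.
  by rewrite -addrA ltr_pwDl // addr_ge0 ?sqr_ge0.
rewrite /hopf_profile /normalized sum4_sqr in re0 im0 re1.
rewrite t0 expr0n addr0 in sph.
rewrite sph sqrtr1 invr1 !mul1r t0 in re0 im0 re1.
have E0 : hopf_coord c 0 = 0 by rewrite -re0 /hopf_coord /=; ring.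
have E1 : hopf_coord c 1 = 0 by rewrite -im0 /hopf_coord /=; ring.
have E2 : hopf_coord c 2 = 0 by rewrite -re1 /hopf_coord /=; ring.
have := hopf_coord_norm c; rewrite sph E0 E1 E2 expr0n expr1n !addr0 => /esym/eqP.
by rewrite oner_eq0.
Qed.

Lemma hopf_profileK (c : nat -> R) j : (j < 3)%N ->
  Num.sqrt (c 0%N ^+ 2 + c 1%N ^+ 2 + c 2%N ^+ 2 + c 3%N ^+ 2) * hopf_profile c j
  = hopf_coord c j.
Proof.
rewrite /hopf_profile /normalized sum4_sqr; set M := _ + _ => j3.
have M0 : 0 <= M by rewrite !addr_ge0 ?sqr_ge0.
have [E|N] := eqVneq (Num.sqrt M) 0; last by rewrite mulrA divff ?mul1r.
rewrite E mul0r.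
have {}M0 : M = 0 by apply/eqP; rewrite eq_le M0 andbT -sqrtr_eq0 E.
have := hopf_coord_norm c; rewrite -/M M0 expr0n => /eqP.
rewrite !paddr_eq0 ?addr_ge0 ?sqr_ge0 // !sqrf_eq0 => /andP[/andP[/eqP e0 /eqP e1] /eqP e2].
by case: j j3 => [|[|[|]]].
Qed.

Lemma hopf_profile_norm (c : nat -> R) :
  hopf_profile c 0 ^+ 2 + hopf_profile c 1 ^+ 2 + hopf_profile c 2 ^+ 2 =
  c 0%N ^+ 2 + c 1%N ^+ 2 + c 2%N ^+ 2 + c 3%N ^+ 2.
Proof.
rewrite /hopf_profile /normalized sum4_sqr; have := hopf_coord_norm c.
set M := _ + c 3%N ^+ 2.
move: (hopf_coord c 0) (hopf_coord c 1) (hopf_coord c 2) => x y z E.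
rewrite !exprMn -!mulrDr E.
have M0 : 0 <= M by rewrite !addr_ge0 ?sqr_ge0.
have [->|N] := eqVneq M 0; first by rewrite expr0n mulr0.
by rewrite exprVn sqr_sqrtr // expr2 mulKf.
Qed.

(** The imaginary part of the second coordinate is again a positive multiple of the
    last coordinate c_5. Where c_5 = 0, the inner product with the target is
    positive at both ends of the segment, hence along it. *)
Lemma segment_avoids_zero_hopf_square :
  segment_avoids_zero 5 (@eta_x0 R \o @eta_lift R) (@eta_x1 R \o @eta_lift R)
    hopf_square_profile.
Proof.
move=> c s s01; rewrite !big_ord_recr big_ord0 /= add0r => sph.
rewrite eta_x1_lift_realC.
set M := c 0%N ^+ 2 + c 1%N ^+ 2 + c 2%N ^+ 2 + c 3%N ^+ 2 in sph *.
have M0 : 0 <= M by rewrite !addr_ge0 ?sqr_ge0.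
set g := hopf_coord c; set k := 1 + g 0%N ^+ 2 + g 2%N ^+ 2.
set x2 := 2 * _ + _ => E0 E1.
have {E1}[re1 im1] : (1 - s) * x2 + s * hopf_square_profile c 2 = 0 /\
    c 5%N * ((1 - s) * ((1 + M / 2) * k - M * g 0%N) + s) = 0.
  by apply: realC_imag_eq0; rewrite -E1; field; rewrite ?pnatr_eq0.
have t0 : c 5%N = 0.
  apply/eqP; move/eqP: im1; rewrite mulf_eq0 => /orP[//|].
  (* With g = g0 and m = M / 2: (1 + m) (1 + g^2) >= 2 (1 + m) |g| > 2 m g
     unless g = 0. *)
  rewrite gt_eqF // segment_pos // /k.
  have := sqr_ge0 (g 2%N); have := sqr_ge0 (1 - g 0%N); have := sqr_ge0 (g 0%N); nra.
move: E0; rewrite eta_x0_lift_realC // -/M -/g.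
set x0 := _ + _ * (g 1%N * g 2%N + _); set x1 := _ - _ * (g 0%N * g 1%N - _) => E0.
have {E0}[re0 im0] : (1 - s) * x0 + s * hopf_square_profile c 0 = 0 /\
    (1 - s) * x1 + s * hopf_square_profile c 1 = 0.
  by apply: realC_imag_eq0; rewrite -E0; ring.
rewrite t0 expr0n addr0 in sph.
rewrite /hopf_square_profile /normalized !big_ord_recr big_ord0 /= add0r -/M
  in re0 im0 re1.
rewrite sph sqrtr1 invr1 !mul1r /hopf_square_coord in re0 im0 re1.
have e0 := sqrtr_ge0 M; have eM := sqr_sqrtr M0.
set e := Num.sqrt M in e0 eM.
have hq j : (j < 3)%N -> e * hopf_profile c j = g j by exact: hopf_profileK.
have qe := hopf_profile_norm c; rewrite -/M -eM in qe.
have et : e ^+ 2 + c 4%N ^+ 2 = 1 by rewrite eM.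
move: hq qe re0 im0 re1; set q := hopf_profile c => hq qe re0 im0 re1.
pose a0 := q 0%N ^+ 2 + q 1%N ^+ 2 - q 2%N ^+ 2 - c 4%N ^+ 2.
pose a1 := 2 * (q 0%N * q 2%N + q 1%N * c 4%N).
pose a2 := 2 * (q 1%N * q 2%N - q 0%N * c 4%N).
have aa : a0 ^+ 2 + a1 ^+ 2 + a2 ^+ 2 = 1.
  have -> : a0 ^+ 2 + a1 ^+ 2 + a2 ^+ 2
    = (q 0%N ^+ 2 + q 1%N ^+ 2 + q 2%N ^+ 2 + c 4%N ^+ 2) ^+ 2 by rewrite /a0 /a1 /a2; ring.
  by rewrite qe et expr1n.
have {}re0 : (1 - s) * x0 + s * a0 = 0 by [].
have {}im0 : (1 - s) * x1 + s * a1 = 0 by [].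
have {}re1 : (1 - s) * x2 + s * a2 = 0 by [].
have := @hopf_comparison_pos R e (c 4%N) (q 0%N) (q 1%N) (q 2%N) _ _ _ _ _
  e0 et qe erefl erefl erefl erefl erefl.
rewrite -/a0 -/a1 -/a2.
set D := (X in 0 < X).
have -> : D = x0 * a0 + x1 * a1 + x2 * a2.
  rewrite /D /x0 /x1 /x2 /k -!hq // -eM.
  by move: a0 a1 a2 {D aa re0 im0 re1} => a0 a1 a2; field; rewrite ?pnatr_eq0.
move=> D0.
have : (1 - s) * (x0 * a0 + x1 * a1 + x2 * a2) + s = 0.
  transitivity (((1 - s) * x0 + s * a0) * a0 + ((1 - s) * x1 + s * a1) * a1
    + ((1 - s) * x2 + s * a2) * a2); last by rewrite re0 im0 re1 !mul0r !addr0.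
  transitivity ((1 - s) * (x0 * a0 + x1 * a1 + x2 * a2)
    + s * (a0 ^+ 2 + a1 ^+ 2 + a2 ^+ 2)); first by rewrite aa mulr1.
  ring.
by apply/eqP; rewrite gt_eqF // segment_pos.
Qed.

End Nonvanishing.

(** * Quadrics as complex spheres *)

Section Coordinates.

(** Beyond the last index this repeats the entry of index 0. *)
Definition entry (A : Type) n (x : 'rV[A]_n.+1) (l : nat) : A := x 0 (inord l).

Lemma entryE (A : Type) n (x : 'rV[A]_n.+1) (j : 'I_n.+1) : x 0 j = entry x j.
Proof. by rewrite /entry inord_val. Qed.

Lemma entry_row (A : Type) n (f : 'I_n.+1 -> A) l : entry (\row_j f j) l = f (inord l).
Proof. by rewrite /entry mxE. Qed.

Lemma sum_pairs (A : nmodType) (F : nat -> A) k :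
  \sum_(l < k.*2) F l = \sum_(l < k) (F l.*2 + F l.*2.+1).
Proof.
elim: k => [|k IH]; first by rewrite !big_ord0.
by rewrite doubleS !big_ord_recr /= IH addrA.
Qed.

End Coordinates.

Section ComplexSphere.
Variable R : realType.
Notation C := (Cplx R).
Notation I := (imag R).

(** The inverse of [quadric_of_squares]; it is affine, so it pulls
    polynomials on the complex sphere back to polynomials on the quadric. *)
Definition squares_of_quadric n (x : 'rV[C]_n.+1) : 'rV[C]_n.+1 :=
  \row_(j < n.+1)
    if ~~ odd n && (j == ord_max) then 2 * x 0 j - 1
    else (if odd n then 2^-1 else 1) *
         (if odd j then - I * (entry x j./2.*2 - entry x j./2.*2.+1)
          else entry x j./2.*2 + entry x j./2.*2.+1).

Lemma pair_index n (j : 'I_n.+1) :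
  ~~ (~~ odd n && (j == ord_max)) -> (j./2.*2.+1 < n.+1)%N.
Proof.
rewrite negb_and negbK => jn.
have le_j : (j <= n)%N by rewrite -ltnS.
have e2 := odd_double_half j.
case: (boolP (odd j)) e2 => oj e2.
  by rewrite -[j./2.*2.+1]/(true + j./2.*2)%N e2.
have lt_j : (j < n)%N; last by rewrite -[j./2.*2]/(false + j./2.*2)%N e2.
rewrite ltn_neqAle le_j andbT; apply: contraNneq oj => jE.
by move: jn; rewrite -val_eqE /= jE eqxx orbF.
Qed.

Lemma last_not_paired n k (b : bool) :
  ~~ odd n -> (k.*2.+1 < n.+1)%N -> (b + k.*2)%N <> n.
Proof.
move=> on + bE; rewrite -bE; move: on; rewrite -bE.
by case: b {bE}; rewrite /= ?ltnn // odd_double.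
Qed.

Lemma quadric_of_squaresK n : cancel (@quadric_of_squares R n) (@squares_of_quadric n).
Proof.
move=> u; apply/rowP => j; rewrite mxE /quadric_of_squares.
have two0 : (2 : C) != 0 by rewrite pnatr_eq0.
case: ifPn => [jm|jn]; first by rewrite mxE jm; field.
have kn := pair_index jn.
set k := j./2 in kn *.
have kn' : (k.*2 < n.+1)%N := ltnW kn.
have E (b : bool) : entry (quadric_of_squares u) (b + k.*2) =
    (if odd n then 1 else 2^-1) *
    (entry u k.*2 + (-1) ^+ odd b * I * entry u k.*2.+1).
  have vl : (inord (b + k.*2) : 'I_n.+1) = (b + k.*2)%N :> nat.
    by rewrite inordK //; case: b.
  rewrite entry_row -val_eqE vl oddD odd_double addbF halfD odd_double andbF.
  rewrite doubleK; case: ifP => [/andP[on /eqP bE]|_]; last by case: (b).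
  have {}bE : (b + k.*2)%N = n by rewrite -vl.
  by case: (last_not_paired on kn bE).
rewrite -[entry _ k.*2]/(entry _ (false + k.*2)) -[entry _ k.*2.+1]/(entry _ (true + k.*2)).
rewrite !E /= mul1r expr1 mulN1r.
have -> : u 0 j = if odd j then entry u k.*2.+1 else entry u k.*2.
  by rewrite entryE -{1}[j : nat]odd_double_half -/k; case: (odd j).
by case: (odd n); case: (odd j); field: (imag_sqr R); rewrite ?two0.
Qed.

Lemma quadric_sphere n (x : 'rV[C]_n.+1) : quadric x ->
  \sum_(l < n.+1) entry (squares_of_quadric x) l ^+ 2 = 1.
Proof.
rewrite /quadric /pairing_sum /= => qx.
have two0 : (2 : C) != 0 by rewrite pnatr_eq0.
have E (b : bool) (k : nat) : (k.*2.+1 < n.+1)%N ->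
  entry (squares_of_quadric x) (b + k.*2) =
   (if odd n then 2^-1 else 1) *
         (if b then - I * (entry x k.*2 - entry x k.*2.+1)
          else entry x k.*2 + entry x k.*2.+1).
  move=> kn; have vl : (inord (b + k.*2) : 'I_n.+1) = (b + k.*2)%N :> nat.
    by rewrite inordK //; case: b => //; exact: ltnW.
  rewrite entry_row -val_eqE vl oddD odd_double addbF halfD odd_double andbF.
  rewrite doubleK; case: ifP => [/andP[on /eqP bE]|_]; last by case: (b).
  have {}bE : (b + k.*2)%N = n by rewrite -vl.
  by case: (last_not_paired on kn bE).
have Epair (k : nat) : (k < n.+1./2)%N ->
  entry (squares_of_quadric x) k.*2 ^+ 2 + entry (squares_of_quadric x) k.*2.+1 ^+ 2 =
  (if odd n then 1 else 4) * (x 0 (inord k.*2) * x 0 (inord k.*2.+1)).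
  move=> kn; have kn' : (k.*2.+1 < n.+1)%N.
    by rewrite -doubleS -geq_half_double.
  have := E false k kn'; have := E true k kn'; rewrite add0n add1n => -> ->.
  rewrite -/(entry x k.*2) -/(entry x k.*2.+1).
  by case: (odd n); field: (imag_sqr R); rewrite ?two0.
have Esum : \sum_(l < n.+1./2.*2) entry (squares_of_quadric x) l ^+ 2 =
   (if odd n then 1 else 4) * (if odd n then 1 else x 0 ord_max * (1 - x 0 ord_max)).
  rewrite -qx (sum_pairs (fun l => entry (squares_of_quadric x) l ^+ 2)) mulr_sumr.
  by apply: eq_bigr => k _; exact: Epair.
have := odd_double_half n.+1; rewrite /=; case: (boolP (odd n)) Esum => on Esum.
  by rewrite add0n => <-; rewrite Esum mulr1.
rewrite add1n => En; rewrite -[in LHS]En big_ord_recr /= Esum.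
rewrite /entry mxE on.
have -> : (inord (uphalf n).*2 : 'I_n.+1) = ord_max.
  by apply/val_inj; rewrite /= inordK; case: En => ->.
by rewrite eqxx /=; ring.
Qed.

End ComplexSphere.

(** * Polynomial functions *)

Section PolynomialFunctions.
Variable R : realType.
Notation C := (Cplx R).

(** Polynomial functions of a sequence of coordinates. Being inductive, the notion
    gives at once, for a polynomial formula, the polynomial that represents it on
    an affine space ([regular_comp]) and its continuity ([cont_on_polyfun]). *)
Inductive polyfun : ((nat -> C) -> C) -> Prop :=
| polyfun_coord l : polyfun (fun c => c l)
| polyfun_cst a : polyfun (fun=> a)
| polyfunD f g : polyfun f -> polyfun g -> polyfun (fun c => f c + g c)
| polyfunM f g : polyfun f -> polyfun g -> polyfun (fun c => f c * g c).

Lemma polyfunN f : polyfun f -> polyfun (fun c => - f c).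
Proof.
move=> pf; have -> : (fun c => - f c) = fun c => -1 * f c.
  by apply/funext => c; rewrite mulN1r.
by apply: polyfunM => //; exact: polyfun_cst.
Qed.

Lemma polyfunX f n : polyfun f -> polyfun (fun c => f c ^+ n).
Proof.
move=> pf; elim: n => [|n IH]; first exact: polyfun_cst.
have -> : (fun c => f c ^+ n.+1) = fun c => f c * f c ^+ n.
  by apply/funext => c; rewrite exprS.
exact: polyfunM.
Qed.

Lemma polyfun_comp (F : (nat -> C) -> C) (G : (nat -> C) -> nat -> C) : polyfun F ->
  (forall l, polyfun (G^~ l)) -> polyfun (fun c => F (G c)).
Proof.
move=> pF pG; elim: pF => [l|a|f g _ pf _ pg|f g _ pf _ pg].
- exact: pG.
- exact: polyfun_cst.
- exact: (polyfunD pf pg).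
- exact: (polyfunM pf pg).
Qed.

Definition regular n (f : 'rV[C]_n.+1 -> C) : Prop :=
  exists p : mpoly.mpoly n.+1 C, 
    forall x : 'rV[C]_n.+1, mpoly.meval (fun k => x 0 k) p = f x.

Lemma regular_ext n (f g : 'rV[C]_n.+1 -> C) : f =1 g -> regular g -> regular f.
Proof. by move=> /funext->. Qed.

Lemma regularD n (f g : 'rV[C]_n.+1 -> C) :
  regular f -> regular g -> regular (fun x => f x + g x).
Proof. by move=> [p pE] [q qE]; exists (p + q) => x; rewrite mpoly.mevalD pE qE. Qed.

Lemma regularM n (f g : 'rV[C]_n.+1 -> C) :
  regular f -> regular g -> regular (fun x => f x * g x).
Proof. by move=> [p pE] [q qE]; exists (p * q) => x; rewrite mpoly.mevalM pE qE. Qed.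

Lemma regular_cst n a : regular (fun _ : 'rV[C]_n.+1 => a).
Proof. by exists (mpoly.mpolyC _ a) => x; rewrite mpoly.mevalC. Qed.

Lemma regular_entry n l : regular (fun x : 'rV[C]_n.+1 => entry x l).
Proof. by exists (mpoly.mpolyX _ (mpoly.mnm1 (inord l))) => x; rewrite mpoly.mevalXU. Qed.

Lemma regular_comp n F (G : nat -> 'rV[C]_n.+1 -> C) : polyfun F ->
  (forall l, regular (G l)) -> regular (fun x => F (fun l => G l x)).
Proof.
move=> pF rG; elim: pF => [l|a|f g _ rf _ rg|f g _ rf _ rg].
- exact: rG.
- exact: regular_cst.
- exact: regularD.
- exact: regularM.
Qed.

Lemma regular_squares_of_quadric n l :
  regular (fun x : 'rV[C]_n.+1 => entry (squares_of_quadric x) l).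
Proof.
apply: (@regular_ext _ _ _ (fun x => entry_row _ l)) => /=; set j := inord l.
have rN (f : 'rV[C]_n.+1 -> C) : regular f -> regular (fun x => - f x).
  move=> rf; apply: (@regular_ext _ _ (fun x => -1 * f x)) => [x|].
    by rewrite mulN1r.
  by apply: regularM => //; exact: regular_cst.
case: (~~ odd n && (j == ord_max)).
  apply: (@regular_ext _ _ (fun x => 2 * entry x j - 1)) => [x|].
    by rewrite entryE.
  apply: regularD; last exact: regular_cst.
  by apply: regularM; [exact: regular_cst | exact: regular_entry].
apply: regularM; first exact: regular_cst.
case: (odd j).
  apply: regularM; first exact: regular_cst.
  by apply: regularD; [|apply: rN]; exact: regular_entry.
by apply: regularD; exact: regular_entry.
Qed.

End PolynomialFunctions.

(** * Continuity on a subset *)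

Section Continuity.

(** Unlike the continuity of a map on a subspace, this form lets the limit theorems
    apply to the values of the map. *)
Definition cont_on (T U : topologicalType) (A : set T) (f : T -> U) :=
  forall x, A x -> f @ within A (nbhs x) --> f x.

Lemma cont_onP (T U : topologicalType) (A : set T) (f : T -> U) :
  {within A, continuous f} <-> cont_on A f.
Proof. exact: subspace_continuousP. Qed.

Lemma cont_on_comp (T U W : topologicalType) (A : set T) (g : U -> W) (f : T -> U) :
  continuous g -> cont_on A f -> cont_on A (g \o f).
Proof. by move=> cg cf x Ax; apply: (cvg_comp _ _ (cf x Ax)); exact: cg. Qed.

Lemma cont_on_cst (T U : topologicalType) (A : set T) (a : U) : cont_on A (fun=> a).
Proof. by move=> x _; exact: cvg_cst. Qed.

Lemma continuous_cont_on (T U : topologicalType) (A : set T) (f : T -> U) :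
  continuous f -> cont_on A f.
Proof. by move=> cf x _; apply: cvg_within_filter; exact: cf. Qed.

Lemma cont_on_snd (S T U : topologicalType) (B : set S) (A : set T) (h : T -> U) :
  cont_on A h -> cont_on (B `*` A) (fun z => h z.2).
Proof.
move=> ch [s v] [/= Bs Av].
apply: (@cvg_comp _ _ _ snd h _ (within A (nbhs v))); last exact: ch.
move=> P /= Pv; have : nbhs (s, v) (snd @^-1` [set y | A y -> P y]).
  by apply: cvg_snd; exact: Pv.
by apply: filterS => -[s' v'] /= H [/= _ /H].
Qed.

Lemma cont_on_mx (T U : topologicalType) (A : set T) n (f : T -> 'rV[U]_n.+1) :
  (forall j, cont_on A (fun x => f x 0 j)) -> cont_on A f.
Proof.
move=> cf x Ax B [P xP sPB].
have F : Filter (within A (nbhs x)) by exact: within_filter.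
have : within A (nbhs x) [set y | forall j, P 0 j (f y 0 j)].
  apply: (@filter_forall T _ (fun j y => P 0 j (f y 0 j)) _ F) => j.
  exact: (cf j x Ax _ (xP 0 j)).
apply: filterS => y Py; apply: sPB => i j; rewrite ord1; exact: Py.
Qed.

Section Field.
Variables (K : numFieldType) (T : topologicalType) (A : set T).
Implicit Types f g : T -> K.

Lemma cont_onD f g : cont_on A f -> cont_on A g -> cont_on A (fun x => f x + g x).
Proof. move=> cf cg x Ax; exact: cvgD (cf x Ax) (cg x Ax). Qed.

Lemma cont_onM f g : cont_on A f -> cont_on A g -> cont_on A (fun x => f x * g x).
Proof. move=> cf cg x Ax; exact: cvgM (cf x Ax) (cg x Ax). Qed.

Lemma cont_onN f : cont_on A f -> cont_on A (fun x => - f x).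
Proof. move=> cf x Ax; exact: cvgN (cf x Ax). Qed.

Lemma cont_onV f : (forall x, A x -> f x != 0) ->
  cont_on A f -> cont_on A (fun x => (f x)^-1).
Proof. move=> f0 cf x Ax; exact: cvgV (f0 x Ax) (cf x Ax). Qed.

Lemma cont_onX f n : cont_on A f -> cont_on A (fun x => f x ^+ n).
Proof.
move=> cf; elim: n => [|n IH]; first exact: cont_on_cst.
rewrite (_ : (fun x => _) = fun x => f x * f x ^+ n); first exact: cont_onM.
by apply/funext => x; rewrite exprS.
Qed.

Lemma cont_on_sum n (f : 'I_n -> T -> K) :
  (forall i, cont_on A (f i)) -> cont_on A (fun x => \sum_(i < n) f i x).
Proof.
elim: n f => [|n IH] f cf.
  rewrite (_ : (fun x => _) = fun=> 0); first exact: cont_on_cst.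
  by apply/funext => x; rewrite big_ord0.
rewrite (_ : (fun x => _) =
    fun x => \sum_(i < n) f (widen_ord (leqnSn n) i) x + f ord_max x).
  by apply: cont_onD => //; exact: IH.
by apply/funext => x; rewrite big_ord_recr.
Qed.

End Field.

Section Real.
Variables (R : realType).
Notation C := (Cplx R).

Lemma continuous_real_complex : continuous (real_complex R : R -> C).
Proof.
move=> x; apply/cvgrPdist_lt => e e0.
have re : 0 < complex.Re e by move: e0; rewrite ltcE => /andP[_].
have eE : e = (complex.Re e)%:C by rewrite RRe_real // realE ltW.
near=> y; rewrite -rmorphB normc_def /= expr0n addr0 sqrtr_sqr eE ltcR.
near: y; exact: (@cvgr_dist_lt _ _ _ _ _ id x cvg_id).
Unshelve. all: by end_near. Qed.

Lemma continuous_conjC : continuous (Num.conj : C -> C).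
Proof.
move=> x; have FF : Filter (nbhs x) by exact: nbhs_filter.
apply/(@cvgrPdist_lt C C _ _ FF) => e e0.
near=> y; rewrite -rmorphB norm_conjC.
near: y; exact: (@cvgr_dist_lt _ _ _ _ _ id x cvg_id).
Unshelve. all: by end_near. Qed.

(** The bound makes the quotient, read as 0 where g vanishes, tend to 0 there. This is
    the continuity of radial extensions at the origin. *)
Lemma cont_on_div (T : topologicalType) (A : set T) (f g : T -> R) :
  cont_on A f -> cont_on A g -> (forall x, `|f x| <= g x ^+ 2) ->
  cont_on A (fun x => (g x)^-1 * f x).
Proof.
move=> cf cg fg x Ax.
have [gx0|gx0] := eqVneq (g x) 0; last first.
  exact: cvgM (cvgV gx0 (cg x Ax)) (cf x Ax).
rewrite gx0 invr0 mul0r.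
have g0 : g @ within A (nbhs x) --> 0 by rewrite -gx0; exact: cg.
apply/cvgrPdist_lt => e e0.
move/cvgrPdist_lt: g0 => /(_ e e0).
apply: filterS => y; rewrite !sub0r !normrN; apply: le_lt_trans.
have [->|gy] := eqVneq (g y) 0; first by rewrite invr0 mul0r normr0.
rewrite normrM normfV ler_pdivrMl ?normr_gt0 // -normrM -expr2.
by rewrite [X in _ <= X]ger0_norm ?sqr_ge0.
Qed.

End Real.

End Continuity.

(** * Homotopies into an odd quadric *)

Section Homotopy.
Variable R : realType.
Notation C := (Cplx R).
Notation I := (imag R).

(** Specializations to the complex numbers, whose field structure cannot be inferred
    from the topology alone. *)
Section Complex.
Variables (T : topologicalType) (A : set T).
Implicit Types f g : T -> C.

Lemma cont_onCD f g : cont_on A f -> cont_on A g -> cont_on A (fun x => f x + g x).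
Proof. exact: (@cont_onD C). Qed.

Lemma cont_onCM f g : cont_on A f -> cont_on A g -> cont_on A (fun x => f x * g x).
Proof. exact: (@cont_onM C). Qed.

Lemma cont_onCN f : cont_on A f -> cont_on A (fun x => - f x).
Proof. exact: (@cont_onN C). Qed.

Lemma cont_onCV f : (forall x, A x -> f x != 0) ->
  cont_on A f -> cont_on A (fun x => (f x)^-1).
Proof. exact: (@cont_onV C). Qed.

Lemma cont_onC_sum n (f : 'I_n -> T -> C) :
  (forall i, cont_on A (f i)) -> cont_on A (fun x => \sum_(i < n) f i x).
Proof. exact: (@cont_on_sum C). Qed.

End Complex.

Lemma cont_on_polyfun (T : topologicalType) (A : set T) F (c : nat -> T -> C) :
  polyfun F -> (forall l, cont_on A (c l)) -> cont_on A (fun x => F (fun l => c l x)).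
Proof.
move=> pF cc; elim: pF => [l|a|f g _ cf _ cg|f g _ cf _ cg].
- exact: cc.
- exact: cont_on_cst.
- exact: cont_onCD.
- exact: cont_onCM.
Qed.

Definition hyperbolic m (X Y : nat -> C) : 'rV[C]_m.+1 :=
  \row_j if odd j then Y j./2 else X j./2.

Lemma quadric_hyperbolic m X Y : odd m ->
  quadric (hyperbolic m X Y) <-> \sum_(k < m.+1./2) X k * Y k = 1.
Proof.
move=> om; rewrite /quadric /pairing_sum /= om.
suff -> : \sum_(k < uphalf m) hyperbolic m X Y 0 (inord k.*2) *
  hyperbolic m X Y 0 (inord k.*2.+1) = \sum_(k < uphalf m) X k * Y k by [].
apply: eq_bigr => k _; have km : (k.*2.+1 < m.+1)%N.
  by rewrite -doubleS -geq_half_double ltn_ord.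
rewrite !mxE !inordK //; last exact: ltnW.
by rewrite /= odd_double /= doubleK uphalf_double.
Qed.

Definition complex_pair (c : nat -> R) (k : nat) : C :=
  (c k.*2)%:C + I * (c k.*2.+1)%:C.

Lemma conj_complex_pair c k :
  Num.conj (complex_pair c k) = (c k.*2)%:C - I * (c k.*2.+1)%:C.
Proof.
by apply/eqP; rewrite eq_complex /=; apply/andP; split; apply/eqP; ring.
Qed.

Lemma sphere_to_quadric_hyperbolic m (g : 'rV[R]_m.+1) : odd m ->
  sphere_to_quadric g =
  hyperbolic m (complex_pair (entry g)) (fun k => Num.conj (complex_pair (entry g) k)).
Proof.
move=> om; apply/rowP => j; rewrite /sphere_to_quadric /quadric_of_squares !mxE om /= mul1r.
rewrite conj_complex_pair /complex_pair -/(imag R) /entry.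
by case: (odd j); rewrite ?expr0 ?expr1 ?mul1r ?mulN1r ?mulNr.
Qed.

Lemma sum_complex_pair_sphere m (g : 'rV[R]_m.+1) : odd m -> sphere g ->
  \sum_(k < m.+1./2)
     complex_pair (entry g) k * Num.conj (complex_pair (entry g) k) = 1.
Proof.
rewrite /sphere /= => om gS.
have mE : m.+1 = m.+1./2.*2 by rewrite -[LHS]odd_double_half /= om.
have -> : (1 : C) = (\sum_(l < m.+1) (entry g l) ^+ 2)%:C.
  rewrite -[LHS](rmorph1 (real_complex R)) -gS; congr (_%:C).
  by apply: eq_bigr => j _; rewrite entryE.
rewrite [in RHS]mE (sum_pairs (fun l => entry g l ^+ 2)) rmorph_sum.
by apply: eq_bigr => k _; rewrite conj_complex_pair /complex_pair; ring: (imag_sqr R).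
Qed.

(** Along the segment Xs of rows, the partner (1 - s) Y of Xs is corrected by the
    multiple of conj Xs that restores the equation Xs.Ys = 1; this is possible
    because Xs.(conj Xs) = |Xs|^2 is nonzero. At s = 0 the correction vanishes, and
    at s = 1 it is conj X_1, the partner of a real point of norm 1. *)
Lemma straight_line_homotopy n m (X Y : nat -> 'rV[R]_n.+1 -> C)
    (f : 'rV[R]_n.+1 -> 'rV[C]_m.+1) (g : 'rV[R]_n.+1 -> 'rV[R]_m.+1) :
  odd m ->
  (forall k, cont_on (@sphere R n) (X k)) ->
  (forall k, cont_on (@sphere R n) (Y k)) ->
  (forall j, cont_on (@sphere R n) (fun v => g v 0 j)) ->
  (forall v, sphere v -> f v = hyperbolic m (X^~ v) (Y^~ v)) ->
  (forall v, sphere v -> \sum_(k < m.+1./2) X k v * Y k v = 1) ->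
  (forall v, sphere v -> sphere (g v)) ->
  (forall v s, sphere v -> 0 <= s <= 1 -> exists k : 'I_m.+1./2,
     (1 - s)%:C * X k v + s%:C * complex_pair (entry (g v)) k != 0) ->
  homotopic_rel R set0 (@sphere R n) (@quadric R m) f (@sphere_to_quadric R m \o g).
Proof.
move=> om cX cY cg fE XY gS nz.
pose Xs k (z : R * 'rV[R]_n.+1) : C :=
  (1 - z.1)%:C * X k z.2 + z.1%:C * complex_pair (entry (g z.2)) k.
pose N (z : R * 'rV[R]_n.+1) := \sum_(k < m.+1./2) Xs k z * Num.conj (Xs k z).
pose D (z : R * 'rV[R]_n.+1) :=
  1 - \sum_(k < m.+1./2) Xs k z * ((1 - z.1)%:C * Y k z.2).
pose Ys k (z : R * 'rV[R]_n.+1) : C :=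
  (1 - z.1)%:C * Y k z.2 + D z * (N z)^-1 * Num.conj (Xs k z).
pose B := `[(0 : R), (1 : R)]%classic `*` @sphere R n.
have N0 (z : R * 'rV[R]_n.+1) : B z -> N z != 0.
  case: z => s v [/= s01 Sv].
  have [|k kn] := nz v s Sv; first by move: s01; rewrite in_itv.
  rewrite psumr_eq0 => [|j _]; last exact: mul_conjC_ge0.
  by apply/allPn; exists k; rewrite ?mem_index_enum //= mul_conjC_eq0.
have c1 (U : topologicalType) (h : 'rV[R]_n.+1 -> U) :
    cont_on (@sphere R n) h -> cont_on B (fun z => h z.2) by exact: cont_on_snd.
have cs : cont_on B (fun z => (z.1)%:C : C).
  apply: continuous_cont_on => z.
  exact: (@continuous_comp _ _ _ fst (real_complex R : R -> C) _
    (@cvg_fst _ _ _ _ _) (@continuous_real_complex R _)).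
have cs1 : cont_on B (fun z => (1 - z.1)%:C : C).
  rewrite (_ : (fun z => _) = fun z => 1 - (z.1)%:C); last first.
    by apply/funext => z; rewrite rmorphB.
  by apply: cont_onCD; [exact: cont_on_cst | exact: cont_onCN].
have cA l : cont_on B (fun z => (entry (g z.2) l)%:C : C).
  apply: (cont_on_comp (@continuous_real_complex R)).
  apply: (c1 R (fun v => entry (g v) l)); exact: cg.
have cXs k : cont_on B (Xs k).
  rewrite /Xs; apply: cont_onCD.
    apply: cont_onCM; [exact: cs1 | exact: c1].
  apply: cont_onCM; first exact: cs.
  rewrite /complex_pair; apply: cont_onCD; first exact: cA.
  apply: cont_onCM; [exact: cont_on_cst | exact: cA].
have cXc k : cont_on B (fun z => Num.conj (Xs k z) : C).
  exact: (cont_on_comp (@continuous_conjC R) (cXs k)).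
have cYk k : cont_on B (fun z => ((1 - z.1)%:C : C) * Y k z.2).
  apply: cont_onCM; [exact: cs1 | exact: c1].
have cD : cont_on B D.
  rewrite /D; apply: cont_onCD; first exact: cont_on_cst.
  apply: cont_onCN; apply: cont_onC_sum => j.
  apply: cont_onCM; [exact: cXs | exact: cYk].
have cN : cont_on B N.
  rewrite /N; apply: cont_onC_sum => j.
  apply: cont_onCM; [exact: cXs | exact: cXc].
have cYs k : cont_on B (Ys k).
  rewrite /Ys; apply: cont_onCD; first exact: cYk.
  apply: cont_onCM; last exact: cXc.
  apply: cont_onCM; first exact: cD.
  apply: cont_onCV; [exact: N0 | exact: cN].
exists (fun z => hyperbolic m (Xs^~ z) (Ys^~ z)); split => //.
- apply/cont_onP; apply: cont_on_mx => j.
  rewrite (_ : (fun z => _) = if odd j then Ys j./2 else Xs j./2); last first.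
    by apply/funext => z; rewrite mxE; case: (odd j).
  case: (odd j); [exact: cYs | exact: cXs].
- move=> s v s01 Sv; apply/quadric_hyperbolic => //.
  have Bz : B (s, v) by split => //=; rewrite in_itv.
  transitivity (\sum_(k < m.+1./2) (Xs k (s, v) * ((1 - s)%:C * Y k v)
     + (D (s, v) * (N (s, v))^-1) * (Xs k (s, v) * Num.conj (Xs k (s, v))))).
    by apply: eq_bigr => k _; rewrite /Ys /=; ring.
  rewrite big_split /= -mulr_sumr -/(N (s, v)) mulfVK ?N0 // /D /=.
  by rewrite addrCA subrr addr0.
- move=> v Sv; rewrite fE //; have D0 : D (0, v) = 0.
    rewrite /D /Xs /=; rewrite -[X in X - _](XY v Sv) -sumrB big1 // => k _.
    by rewrite subr0; ring.
  congr (hyperbolic m _ _); apply/funext => k; rewrite /Ys /Xs /= ?D0 subr0; ring.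
- move=> v Sv; rewrite /= sphere_to_quadric_hyperbolic //.
  have X1E k : Xs k (1, v) = complex_pair (entry (g v)) k by rewrite /Xs /= subrr; ring.
  have N1 : N (1, v) = 1.
    by rewrite -(sum_complex_pair_sphere om (gS v Sv)); apply: eq_bigr => k _; rewrite X1E.
  have D1 : D (1, v) = 1.
    by rewrite /D /= subrr big1 ?subr0 // => k _; rewrite !rmorph0 mul0r mulr0.
  congr (hyperbolic m _ _); apply/funext => k //.
  by rewrite /Ys /= D1 N1 X1E subrr invr1 !mul1r rmorph0 mul0r add0r.
Qed.

End Homotopy.

(** * Iterated suspensions in closed form *)

Section Suspension.
Variable R : realType.

(** What suspension uses of a map f from R^p to R^3: positive homogeneity of degree
    d, the norm |f c| = |c|^d and continuity. *)
Record homogeneous (d p : nat) (f : (nat -> R) -> nat -> R) : Prop := {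
  homog_local : forall c c' j, (forall l, (l < p)%N -> c l = c' l) -> f c j = f c' j;
  homog_scale : forall a c j, 0 <= a -> f (fun l => a * c l) j = a ^+ d * f c j;
  homog_norm : forall c,
    f c 0%N ^+ 2 + f c 1%N ^+ 2 + f c 2%N ^+ 2 = (\sum_(l < p) c l ^+ 2) ^+ d;
  homog_cont : forall (T : topologicalType) (A : set T) (c : nat -> T -> R) j,
    (j < 3)%N -> (forall l, cont_on A (c l)) -> cont_on A (fun x => f (c^~ x) j) }.

Lemma homogeneous_hopf_coord : homogeneous 2 4 (@hopf_coord R).
Proof.
split.
- move=> c c' j cc'; rewrite /hopf_coord.
  by rewrite (cc' 0) // (cc' 1) // (cc' 2) // (cc' 3).
- move=> a c j _; case: j => [|[|[|j]]]; rewrite /hopf_coord /=;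
    first [ring | by rewrite !nth_nil mulr0].
- by move=> c; rewrite hopf_coord_norm sum4_sqr.
- move=> T A c j j3 cc.
  pose m (k l : nat) := fun x => c k x * c l x.
  have cm k l : cont_on A (m k l) by apply: cont_onM; exact: cc.
  have E x : hopf_coord (c^~ x) j =
    [:: m 0%N 0%N x + m 1%N 1%N x - m 2%N 2%N x - m 3%N 3%N x;
        2 * (m 0%N 2%N x + m 1%N 3%N x); 2 * (m 1%N 2%N x - m 0%N 3%N x)]`_j by [].
  rewrite (funext E).
  have cD (f g : T -> R) : cont_on A f -> cont_on A g -> cont_on A (fun x => f x + g x).
    exact: cont_onD.
  have cN (f : T -> R) : cont_on A f -> cont_on A (fun x => - f x) by exact: cont_onN.
  have c2 (f : T -> R) : cont_on A f -> cont_on A (fun x => 2 * f x).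
    by move=> cf; apply: cont_onM => //; exact: cont_on_cst.
  case: j j3 {E} => [|[|[|//]]] _ /=.
  + by do 2 (apply: (cD _ (fun x => - _)); last exact: cN); exact: cD.
  + by apply: c2; exact: cD.
  + by apply: c2; apply: (cD _ (fun x => - _)) => //; exact: cN.
Qed.

Lemma sqrt_sum_scale p (c : nat -> R) a : 0 <= a ->
  Num.sqrt (\sum_(l < p) (a * c l) ^+ 2) = a * Num.sqrt (\sum_(l < p) c l ^+ 2).
Proof.
move=> a0; under eq_bigr do rewrite exprMn.
by rewrite -mulr_sumr sqrtrM ?sqr_ge0 // sqrtr_sqr ger0_norm.
Qed.

Lemma sum_sqr_ge0 p (c : nat -> R) : 0 <= \sum_(l < p) c l ^+ 2.
Proof. by apply: sumr_ge0 => l _; exact: sqr_ge0. Qed.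

Lemma homogeneous_normalized p f : homogeneous 2 p f -> homogeneous 1 p (normalized p f).
Proof.
case=> loc sca nor con; split.
- move=> c c' j cc'; rewrite /normalized (loc _ _ _ cc'); congr ((Num.sqrt _)^-1 * _).
  by apply: eq_bigr => l _; rewrite cc'.
- move=> a c j a0; rewrite /normalized sqrt_sum_scale // sca // expr1.
  have [->|a0'] := eqVneq a 0; first by rewrite expr0n /= !mul0r mulr0.
  rewrite invfM; move: (Num.sqrt _)^-1 (f c j) => x y.
  by transitivity (a^-1 * a * (a * (x * y))); [ring | rewrite mulVf ?mul1r].
- move=> c; rewrite /normalized !exprMn -!mulrDr nor expr1.
  have S0 := sum_sqr_ge0 p c; set S := \sum_(_ < _) _ in S0 *.
  have [->|N] := eqVneq S 0; first by rewrite expr0n mulr0.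
  by rewrite exprVn sqr_sqrtr // expr2 mulKf.
- move=> T A c j j3 cc; rewrite /normalized; apply: cont_on_div; first exact: con.
    apply: (@cont_on_comp _ _ _ A (@Num.sqrt R) (fun x => \sum_(l < p) c l x ^+ 2)).
      exact: sqrt_continuous.
    by apply: cont_on_sum => l; apply: cont_onX; exact: cc.
  move=> x; have S0 := sum_sqr_ge0 p (c^~ x); rewrite sqr_sqrtr //.
  rewrite -ler_sqr ?nnegrE ?normr_ge0 // real_normK ?num_real // -(nor (c^~ x)).
  by case: j j3 => [|[|[|//]]] _; have := sqr_ge0 (f (c^~ x) 0%N);
    have := sqr_ge0 (f (c^~ x) 1%N); have := sqr_ge0 (f (c^~ x) 2%N); lra.
Qed.

Lemma homogeneous_hopf_square_coord : homogeneous 2 5 (@hopf_square_coord R).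
Proof.
have [loc sca nor con] := homogeneous_hopf_coord.
have [loc1 sca1 nor1 con1] := homogeneous_normalized homogeneous_hopf_coord.
split.
- move=> c c' j cc'; apply: loc => l l4; rewrite (cc' 4) //.
  by rewrite /hopf_profile (loc1 c c' l) // => k k4; apply: cc'; exact: ltnW.
- move=> a c j a0; rewrite -sca //; congr (hopf_coord _ j); apply/funext => l.
  by case: ifP => // _; rewrite /hopf_profile sca1 // expr1.
- move=> c; rewrite nor (sum4_sqr (fun l => if (l < 3)%N then hopf_profile c l else c 4%N)).
  rewrite /= /hopf_profile nor1 expr1.
  by rewrite [in RHS]big_ord_recr.
- move=> T A c j j3 cc.
  apply: (con T A (fun l x => if (l < 3)%N then hopf_profile (c^~ x) l else c 4%N x)) => // l.
  by case: ltnP => l3; [exact: con1 | exact: cc].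
Qed.

(** The shape of an iterated suspension: f acts on the first 3 + s coordinates, and
    the suspension parameters, of index 3 + s and above, are copied. *)
Definition susp_form n m s (f : (nat -> R) -> nat -> R) (v : 'rV[R]_n.+1) :
    'rV[R]_m.+1 :=
  \row_(j < m.+1) if (j < 3)%N then f (entry v) j else entry v (j + s).

Section OneSuspension.
Variables (n : nat) (v : 'rV[R]_n.+2).
Let u : 'rV[R]_n.+1 := \row_j v 0 (lift ord_max j).
Let r := Num.sqrt (\sum_j u 0 j ^+ 2).

Lemma entry_truncate l : (l < n.+1)%N -> entry u l = entry v l.
Proof.
move=> ln; rewrite /entry mxE; congr (v 0 _); apply/ord_inj.
by rewrite lift_max !inordK // ltnW.
Qed.

Lemma entry_scale a l : entry (a *: u) l = a * entry u l.
Proof. by rewrite /entry mxE. Qed.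

Lemma norm_truncate : r = Num.sqrt (\sum_(l < n.+1) entry v l ^+ 2).
Proof. by congr Num.sqrt; apply: eq_bigr => l _; rewrite entryE entry_truncate. Qed.

(** Also for r = 0: then the truncated vector is 0. *)
Lemma unscale l : (l < n.+1)%N -> r * (r^-1 * entry u l) = entry v l.
Proof.
move=> ln; rewrite entry_truncate //; have [r0|r0] := eqVneq r 0; last by rewrite mulVKf.
rewrite r0 mul0r; move: r0; rewrite norm_truncate => /eqP; rewrite sqrtr_eq0 => le0.
have /eqP : \sum_(l < n.+1) entry v l ^+ 2 = 0.
  by apply/eqP; rewrite eq_le le0 sum_sqr_ge0.
rewrite psumr_eq0 => [|i _]; last exact: sqr_ge0.
move/allP => /(_ (Ordinal ln)); rewrite mem_index_enum => /(_ isT) /=.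
by rewrite sqrf_eq0 => /eqP.
Qed.

Lemma suspE m (f : 'rV[R]_n.+1 -> 'rV[R]_m.+1) j : (j < m.+2)%N ->
  entry (susp f v) j =
  if (j < m.+1)%N then r * entry (f (r^-1 *: u)) j else entry v n.+1.
Proof.
move=> jm; rewrite {1}/entry /susp mxE -/u -/r.
have vj : (inord j : 'I_m.+2) = j :> nat by rewrite inordK.
case: unliftP => [k kE|jE].
  have -> : j = k by rewrite -vj kE lift_max.
  by rewrite ltn_ord -entryE.
have -> : j = m.+1 by rewrite -vj jE.
by rewrite ltnn /entry; congr (v 0 _); apply/val_inj; rewrite /= inordK.
Qed.

Lemma susp_hopf_like s (f : 'rV[R]_n.+1 -> 'rV[R]_3) g :
  n.+1 = (3 + s)%N -> homogeneous 2 n.+1 g ->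
  (forall w j, (j < 3)%N -> entry (f w) j = g (entry w) j) ->
  susp f v = susp_form 3 s (normalized n.+1 g) v.
Proof.
move=> ns [loc sca _ _] fg; apply/rowP => j; rewrite !entryE suspE //.
rewrite [in RHS]/entry mxE inord_val; case: ifP => j3; last first.
  have -> : j = 3 :> nat by apply/eqP; rewrite eqn_leq -ltnS ltn_ord leqNgt j3.
  by rewrite -ns.
rewrite fg //.
have -> : g (entry (r^-1 *: u)) j = g (fun l => r^-1 * entry v l) j.
  by apply: loc => l ln; rewrite entry_scale entry_truncate.
rewrite sca ?invr_ge0 ?sqrtr_ge0 // /normalized -norm_truncate.
by have [->|r0] := eqVneq r 0; [rewrite invr0 !mul0r | rewrite expr2 !mulrA divff ?mul1r].
Qed.

(** A further suspension changes nothing in the first three coordinates, since f is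
    homogeneous of degree 1. *)
Lemma susp_susp_form m s p f : n = (m + s)%N -> (2 <= m)%N -> (p <= 3 + s)%N ->
  homogeneous 1 p f ->
  susp (@susp_form n m s f) v = susp_form m.+1 s f v.
Proof.
move=> nm m2 ps [loc sca _ _]; apply/rowP => j; rewrite !entryE suspE //.
rewrite [in RHS]/entry mxE inord_val.
have [jm|mj] := ltnP j m.+1; last first.
  have -> : j = m.+1 :> nat by apply/eqP; rewrite eqn_leq -ltnS ltn_ord.
  by rewrite ltnNge ltnS m2 /= addSn -nm.
rewrite {1}/entry mxE inordK //; case: ifP => [j3|_]; last first.
  by rewrite entry_scale unscale // ltnS nm leq_add2r.
transitivity (f (fun l => r * entry (r^-1 *: u) l) j).
  by rewrite sca ?sqrtr_ge0 // expr1.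
apply: loc => l lp; rewrite entry_scale unscale // ltnS nm.
by apply: (@leq_trans (2 + s)); [rewrite -ltnS (leq_trans lp) | rewrite leq_add2r].
Qed.

End OneSuspension.

Lemma hopf_suspE k v :
  hopf_susp R k.+1 v = susp_form (3 + k) 1 (@hopf_profile R) v.
Proof.
have H1 := homogeneous_normalized homogeneous_hopf_coord.
elim: k v => [|k IH] v.
  apply: (@susp_hopf_like 3 v 1 _ _ erefl homogeneous_hopf_coord) => w j j3.
  by rewrite {1}/entry /hopf mxE inordK.
rewrite -[LHS]/(susp (@hopf_susp R k.+1) v) (funext IH).
by apply: susp_susp_form (H1) => //; rewrite !(addSn, addnS, addn0, add0n).
Qed.

Lemma hopf_square_suspE k v :
  hopf_square_susp R k.+1 v = susp_form (3 + k) 2 (@hopf_square_profile R) v.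
Proof.
have H1 := homogeneous_normalized homogeneous_hopf_square_coord.
elim: k v => [|k IH] v.
  apply: (@susp_hopf_like 4 v 2 _ _ erefl homogeneous_hopf_square_coord) => w j j3.
  rewrite {1}/entry /hopf_square /= {1}/hopf mxE inordK //.
  rewrite -/(hopf_coord (entry (susp (@hopf R) w)) j).
  apply: (homog_local homogeneous_hopf_coord) => l l4.
  have -> : susp (@hopf R) w = _ := @hopf_suspE 0 w.
  rewrite /entry mxE inordK //.
  by case: ltnP => // l3; have -> : l = 3 by apply/eqP; rewrite eqn_leq l3 andbT.
rewrite -[LHS]/(susp (@hopf_square_susp R k.+1) v) (funext IH).
by apply: susp_susp_form (H1) => //; rewrite !(addSn, addnS, addn0, add0n).
Qed.

Lemma sphere_susp_form n m s f v : n = (m + s)%N -> (2 <= m)%N ->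
  homogeneous 1 (3 + s) f -> @sphere R n v -> sphere (susp_form m s f v).
Proof.
move=> nm m2 Hf; rewrite /sphere /= => <-.
transitivity (\sum_(j < m.+1)
    (if (j < 3)%N then f (entry v) j else entry v (j + s)) ^+ 2).
  by apply: eq_bigr => j _; rewrite mxE.
transitivity (\sum_(j < n.+1) entry v j ^+ 2); last by apply: eq_bigr => j _; rewrite entryE.
have -> : m.+1 = (3 + (m - 2))%N by rewrite addSn subnKC.
have -> : n.+1 = (3 + s + (m - 2))%N by rewrite nm addnAC addSn subnKC // addSn.
rewrite [LHS]big_split_ord [RHS]big_split_ord /=; congr (_ + _); last first.
  by apply: eq_bigr => j _; rewrite /= addnAC.
transitivity (\sum_(l < 3 + s) entry v l ^+ 2) => //.
have := homog_norm Hf (entry v); rewrite expr1 => <-.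
by rewrite !big_ord_recr big_ord0 /= add0r.
Qed.

Lemma cont_on_susp_form n m s f (A : set 'rV[R]_n.+1) j :
  homogeneous 1 (3 + s) f -> cont_on A (fun v => susp_form m s f v 0 j).
Proof.
move=> Hf.
have cc l : cont_on A (fun v : 'rV[R]_n.+1 => entry v l).
  by apply: continuous_cont_on; exact: coord_continuous.
rewrite (_ : (fun v => _) = if (j < 3)%N then fun v => f (entry v) j
   else fun v => entry v (j + s)); last by apply/funext => v; rewrite mxE; case: ifP.
case: ifP => j3; last exact: cc.
exact: (homog_cont Hf j3 cc).
Qed.

End Suspension.

(** * Suspension of polynomial rows *)

Section Assembly.
Variable R : realType.
Notation C := (Cplx R).
Notation I := (imag R).

Ltac polyfun :=
  repeat first [exact: polyfun_coord | exact: polyfun_cst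
               | apply: polyfunD | apply: polyfunN | apply: polyfunM | apply: polyfunX].

Lemma polyfun_hopf_coord j : polyfun (fun c : nat -> C => hopf_coord c j).
Proof. case: j => [|[|[|j]]]; rewrite /hopf_coord /= ?nth_nil; polyfun. Qed.

Lemma polyfun_eta : [/\ polyfun (@eta_x0 R), polyfun (@eta_x1 R), polyfun (@eta_y0 R),
  polyfun (@eta_y1 R) & polyfun (@eta_weight R)].
Proof.
by split; rewrite /eta_x0 /eta_x1 /eta_y0 /eta_y1 /eta_weight /hopf_coord /=; polyfun.
Qed.

Lemma polyfun_eta_lift l : polyfun (fun c : nat -> C => eta_lift c l).
Proof.
have [_ _ _ _ ph] := polyfun_eta.
case: l => [|[|[|[|[|l]]]]]; try exact: polyfun_hopf_coord.
all: rewrite /eta_lift; apply: polyfunD; first exact: polyfun_coord.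
all: apply: polyfunM; last by polyfun.
all: apply: polyfunM; last exact: polyfun_cst.
all: by apply: polyfunD; [exact: ph | polyfun].
Qed.

(** Suspension of the row (F0, F1) in the coordinates of index p and above. For
    h = 1 and e = i this is the suspended row X; for e = - i, and h as in
    [suspended_unimodular], its partner Y. *)
Definition suspended_coord p (F0 F1 h : (nat -> C) -> C) (e : C) (k : nat)
    (c : nat -> C) : C :=
  match k with
  | 0 => F0 c
  | 1 => F1 c
  | k'.+2 => h c * (c (p + k'.*2)%N + e * c (p + k'.*2.+1)%N)
  end.

Lemma polyfun_suspended_coord p F0 F1 h e k : polyfun F0 -> polyfun F1 -> polyfun h ->
  polyfun (suspended_coord p F0 F1 h e k).
Proof.
move=> p0 p1 ph; case: k => [|[|k]] //=.
by apply: polyfunM => //; polyfun.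
Qed.

(** If \sum_(l < p) c_l^2 - 1 multiplies h in F.G, then on the larger sphere this
    factor is minus the sum of the squares of the new coordinates; their products
    (c + i c') h (c - i c') compensate for it. *)
Lemma suspended_unimodular p i F0 F1 G0 G1 h (c : nat -> C) :
  F0 c * G0 c + F1 c * G1 c = 1 + (\sum_(l < p) c l ^+ 2 - 1) * h c ->
  \sum_(l < p + i.*2) c l ^+ 2 = 1 ->
  \sum_(k < 2 + i) suspended_coord p F0 F1 (fun=> 1) I k c
                  * suspended_coord p G0 G1 h (- I) k c = 1.
Proof.
move=> FG; rewrite big_split_ord (sum_pairs (fun l => c (p + l)%N ^+ 2)) /= => S1.
rewrite big_ord_recl big_ord_recl /= addrA FG.
have -> : \sum_(k < i)
    suspended_coord p F0 F1 (fun=> 1) I (lift ord0 (lift ord0 k)) c *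
    suspended_coord p G0 G1 h (- I) (lift ord0 (lift ord0 k)) c =
    h c * \sum_(k < i) (c (p + k.*2)%N ^+ 2 + c (p + k.*2.+1)%N ^+ 2).
  by rewrite mulr_sumr; apply: eq_bigr => k _ /=; ring: (imag_sqr R).
have -> : \sum_(k < i) (c (p + k.*2)%N ^+ 2 + c (p + k.*2.+1)%N ^+ 2) =
    1 - \sum_(l < p) c l ^+ 2.
  by rewrite -S1 [X in _ = X - _]addrC addrK.
ring.
Qed.

(** A unimodular row of length 2 and a segment from it to alpha that misses 0, both
    in the lowest dimension, yield representatives of all even suspensions: the
    new coordinates are constant along the segment, so where it could vanish they
    are 0 and the first 4 + s coordinates lie on the smaller sphere. *)
Lemma suspended_representative n m s i F0 F1 G0 G1 h f
    (alpha : 'rV[R]_n.+1 -> 'rV[R]_m.+1) :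
  n = (m + s)%N -> m.+1 = (2 + i).*2 ->
  polyfun F0 -> polyfun F1 -> polyfun G0 -> polyfun G1 -> polyfun h ->
  (forall c : nat -> C,
     F0 c * G0 c + F1 c * G1 c = 1 + (\sum_(l < 4 + s) c l ^+ 2 - 1) * h c) ->
  segment_avoids_zero (3 + s) F0 F1 f ->
  homogeneous 1 (3 + s) f ->
  alpha =1 susp_form m s f ->
  exists p : 'I_m.+1 -> mpoly.mpoly n.+1 C, polynomial_representative p alpha.
Proof.
move=> nm mi pF0 pF1 pG0 pG1 ph FG nv hf alphaE.
have om : odd m by have := congr1 odd mi; rewrite /= odd_double => /negbFE.
have hm : m.+1./2 = (2 + i)%N by rewrite mi doubleK.
have n1 : n.+1 = (4 + s + i.*2)%N.
  by rewrite nm -addSn mi doubleD addnAC.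
have m2 : (2 <= m)%N by rewrite -ltnS mi.
pose X k (c : nat -> C) := suspended_coord (4 + s) F0 F1 (fun=> 1) I k c.
pose Y k (c : nat -> C) := suspended_coord (4 + s) G0 G1 h (- I) k c.
have pX k : polyfun (X k) by apply: polyfun_suspended_coord => //; exact: polyfun_cst.
have pY k : polyfun (Y k) by exact: polyfun_suspended_coord.
have XY (c : nat -> C) : \sum_(l < n.+1) c l ^+ 2 = 1 ->
    \sum_(k < m.+1./2) X k c * Y k c = 1.
  by rewrite hm n1; exact: suspended_unimodular.
pose u (x : 'rV[C]_n.+1) := entry (squares_of_quadric x).
have /boolp.choice[p pE] : forall j : 'I_m.+1, exists q : mpoly.mpoly n.+1 C,
    forall x : 'rV[C]_n.+1, mpoly.meval (fun k => x 0 k) q =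
      hyperbolic m (X^~ (u x)) (Y^~ (u x)) 0 j.
  move=> j; pose F := if odd j then Y j./2 else X j./2.
  have [q qE] := @regular_comp R n F (fun l x => u x l)
     ltac:(by rewrite /F; case: (odd j)) (@regular_squares_of_quadric R n).
  exists q => x; rewrite qE mxE /F.
  by case: (odd j).
have polyE x : polymap p x = hyperbolic m (X^~ (u x)) (Y^~ (u x)).
  by apply/rowP => j; rewrite mxE pE.
exists p; split.
  move=> x /quadric_sphere qx; rewrite polyE; apply/quadric_hyperbolic => //; exact: XY.
have uE v : u (sphere_to_quadric v) = realC (entry v).
  by rewrite /u quadric_of_squaresK; apply/funext => l; rewrite /entry mxE.
have sphereC (v : 'rV[R]_n.+1) : sphere v -> \sum_(l < n.+1) realC (entry v) l ^+ 2 = 1.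
  rewrite /sphere /= => /(congr1 (real_complex R)); rewrite rmorph_sum rmorph1 => <-.
  by apply: eq_bigr => l _; rewrite entryE rmorphXn.
have cont_alpha j : cont_on (@sphere R n) (fun v => alpha v 0 j).
  by rewrite (funext alphaE); exact: cont_on_susp_form.
have alphaS v : sphere v -> sphere (alpha v).
  by move=> Sv; rewrite alphaE; apply: sphere_susp_form Sv.
have ccoord l : cont_on (@sphere R n) (fun v => realC (entry v) l).
  apply: (cont_on_comp (@continuous_real_complex R)).
  by apply: continuous_cont_on; exact: coord_continuous.
exists alpha; split.
  exists (fun z => alpha z.2); split => //; last by move=> t x _ Sx; exact: alphaS.
  apply/cont_onP; apply: cont_on_mx => j.
  exact: (cont_on_snd (cont_alpha j)).
apply: (@straight_line_homotopy R n m (fun k v => X k (realC (entry v)))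
          (fun k v => Y k (realC (entry v)))).
- exact: om.
- by move=> k; exact: (cont_on_polyfun (pX k) ccoord).
- by move=> k; exact: (cont_on_polyfun (pY k) ccoord).
- exact: cont_alpha.
- by move=> v _; rewrite /= polyE uE.
- by move=> v Sv; exact/XY/sphereC.
- exact: alphaS.
- move=> v s' Sv s01.
  have [//|none] := pselect (exists k : 'I_m.+1./2,
    (1 - s')%:C * X k (realC (entry v)) + s'%:C * complex_pair (entry (alpha v)) k != 0).
  exfalso.
  have allz k : (k < 2 + i)%N ->
      (1 - s')%:C * X k (realC (entry v)) + s'%:C * complex_pair (entry (alpha v)) k = 0.
    move=> ki; have km : (k < m.+1./2)%N by rewrite hm.
    apply/eqP; apply: contrapT => /negP nk; apply: none.
    by exists (Ordinal km).
  have alphac j : (j < m.+1)%N ->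
      entry (alpha v) j = if (j < 3)%N then f (entry v) j else entry v (j + s).
    by move=> jm; rewrite alphaE entry_row inordK.
  have z0 k : (k < i)%N -> entry v (4 + s + k.*2) = 0 /\ entry v (4 + s + k.*2.+1) = 0.
    move=> ki; apply: realC_imag_eq0.
    have lt2 : (k.+2.*2.+1 < m.+1)%N by rewrite mi -doubleS leq_double.
    have := allz k.+2 ki; rewrite /X /= /complex_pair !alphac //; last exact: ltnW.
    rewrite /= !doubleS.
    have -> : (k.*2.+4 + s = 4 + s + k.*2)%N by rewrite addnAC.
    have -> : (k.*2.+4.+1 + s = 4 + s + k.*2.+1)%N by rewrite addnS addnAC.
    move=> <-; rewrite /realC; ring.
  have S1 : \sum_(l < (3 + s).+1) entry v l ^+ 2 = 1.
    have : \sum_(l < n.+1) entry v l ^+ 2 = 1.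
      by move: Sv; rewrite /sphere /= => <-; apply: eq_bigr => l _; rewrite entryE.
    rewrite n1 big_split_ord /= [X in _ + X](_ : _ = 0) ?addr0 //.
    rewrite (sum_pairs (fun l => entry v (4 + s + l) ^+ 2)) big1 // => k _.
    by have [-> ->] := z0 k (ltn_ord k); rewrite expr0n /= addr0.
  have m4 j : (j < 4)%N -> (j < m.+1)%N.
    by move=> j4; rewrite mi doubleD (leq_trans j4) // leq_addr.
  have E0 := allz 0 isT; have E1 := allz 1 isT.
  apply: (nv (entry v) s' s01 S1).
  + by rewrite -[RHS]E0 /complex_pair !alphac ?m4.
  + by rewrite -[RHS]E1 /complex_pair !alphac ?m4.
Qed.

End Assembly.

Theorem proposition2p2p1 (R : realType) (i : nat) :
  (exists p : 'I_(3 + 2 * i).+1 -> mpoly.mpoly (4 + 2 * i).+1 (Cplx R),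
     @polynomial_representative R (4 + 2 * i) (3 + 2 * i) p
       (hopf_susp R (2 * i).+1)) /\
  (exists q : 'I_(3 + 2 * i).+1 -> mpoly.mpoly (5 + 2 * i).+1 (Cplx R),
     @polynomial_representative R (5 + 2 * i) (3 + 2 * i) q
       (hopf_square_susp R (2 * i).+1)).
Proof.
have [pX0 pX1 pY0 pY1 ph] := polyfun_eta R.
have pl := @polyfun_eta_lift R.
have mi : ((3 + 2 * i).+1 = (2 + i).*2)%N by rewrite doubleD mul2n.
split.
- apply: (@suspended_representative R _ _ 1 i (@eta_x0 R) (@eta_x1 R) (@eta_y0 R)
    (@eta_y1 R) (@eta_weight R) (@hopf_profile R)) => //.
  + by rewrite addn1.
  + by move=> c; rewrite eta_unimodular !big_ord_recr big_ord0 /= add0r.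
  + exact: segment_avoids_zero_hopf.
  + exact: homogeneous_normalized (@homogeneous_hopf_coord R).
  + exact: hopf_suspE.
- apply: (@suspended_representative R _ _ 2 i
    (@eta_x0 R \o @eta_lift R) (@eta_x1 R \o @eta_lift R)
    (@eta_y0 R \o @eta_lift R) (@eta_y1 R \o @eta_lift R)
    (fun c => eta_weight c * eta_weight (eta_lift c)) (@hopf_square_profile R)) => //;
    try exact: polyfun_comp.
  + by rewrite addn2.
  + by apply: polyfunM => //; exact: polyfun_comp.
  + move=> c; rewrite /= eta_unimodular eta_lift_norm !big_ord_recr big_ord0 /= add0r.
    by rewrite mulrA.
  + exact: segment_avoids_zero_hopf_square.
  + exact: homogeneous_normalized (@homogeneous_hopf_square_coord R).
  + exact: hopf_square_suspE.
Qed.
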